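(* Let $\mathbb{F}$ be a field of characteristic zero, $V_2$ a 2-dimensional $\mathbb{F}$-vector space with basis $v_1,v_2$, and let $W(2)$ and its subalgebras $W_2$ and $S_2$ be as defined in the context. Let $GL(V_2,v_1)=\{f\in GL(V_2)\mid f(v_1)=v_1\}$ and let $\Phi:GL(V_2,v_1)\to \mathrm{Aut}(W(2))$ be the group homomorphism defined by $$\big(\Phi(f)(A)\big)(x,y)=f\big(A(f^{-1}(x),f^{-1}(y))\big)\qquad (A\in W(2),\ x,y\in V_2).$$ Then $\Phi$ is bijective. Moreover, the homomorphisms $GL(V_2,v_1)\to\mathrm{Aut}(W_2)$ and $GL(V_2,v_1)\to\mathrm{Aut}(S_2)$ induced by restricting each $\Phi(f)$ to $W_2$ and to $S_2$, respectively, are bijective too. In other words, $\mathrm{Aut}(W(2))\cong\mathrm{Aut}(W_2)\cong\mathrm{Aut}(S_2)$ is isomorphic to the matrix group $\left\{\begin{pmatrix}1 & a\\ 0 & b\end{pmatrix}\;\middle|\; a\in\mathbb{F},\ b\in\mathbb{F}^*\right\}$ (the one-dimensional affine group over $\mathbb{F}$).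
   Context: $W(2)$ is the vector space of all bilinear maps $V_2\times V_2\to V_2$ with the (not necessarily associative, not necessarily unital) product $$(A\cdot B)(x,y)=A(v_1,B(x,y))-B(A(v_1,x),y)-B(x,A(v_1,y)),\qquad x,y\in V_2.$$ For $i,j,k\in\{1,2\}$ let $\alpha_{ij}^k\in W(2)$ be given by $\alpha_{ij}^k(v_t,v_l)=\delta_{it}\delta_{jl}v_k$. Put $e_1=\alpha_{11}^1-\alpha_{12}^2-\alpha_{21}^2$, $e_2=\alpha_{11}^2$, $e_3=\alpha_{22}^2-\alpha_{12}^1-\alpha_{21}^1$, $e_4=\alpha_{22}^1$, $e_5=2\alpha_{11}^1+\alpha_{12}^2+\alpha_{21}^2$, $e_6=2\alpha_{22}^2+\alpha_{12}^1+\alpha_{21}^1$. $W_2$ is the subalgebra of $W(2)$ with basis $e_1,\dots,e_6$, and $S_2$ is the subalgebra of $W(2)$ with basis $e_1,\dots,e_4$. Each $\Phi(f)$ is an algebra automorphism of $W(2)$ mapping $W_2$ onto $W_2$ and $S_2$ onto $S_2$. $\mathrm{Aut}$ denotes the group of $\mathbb{F}$-algebra automorphisms. *)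

(* Defs.v *)
(* boolp is used only to turn propositions into boolean subtype predicates,
   written [< P >]. *)
From HB Require Import structures.
From mathcomp Require Import all_boot all_order all_algebra.
From mathcomp Require Import boolp.
From mathcomp Require Import ring.

Set Implicit Arguments.
Unset Strict Implicit.
Unset Printing Implicit Defensive.

Import GRing.Theory.
Local Open Scope ring_scope.

Definition group_isomorphic (G H : groupType) : Prop :=
  exists phi : {multiplicative G -> H}, bijective phi.

Section Lfun.
Context {F : fieldType} {U : vectType F}.
Implicit Types f g : 'End(U).

Lemma bij_lker0 f : bijective f -> lker f == 0%VS.
Proof. by move=> /bij_inj /lker0P. Qed.

Lemma lker0_bij f : lker f == 0%VS -> bijective f.
Proof. by move=> kf; exists f^-1%VF; [exact: lker0_lfunK|exact: lker0_lfunVK]. Qed.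

Lemma bij_lfunK f : bijective f -> cancel f f^-1%VF.
Proof. by move=> /bij_lker0 /lker0_lfunK. Qed.

Lemma bij_lfunVK f : bijective f -> cancel f^-1%VF f.
Proof. by move=> /bij_lker0 /lker0_lfunVK. Qed.

Lemma bij_lfun1 : bijective (\1%VF : 'End(U)).
Proof. by exists idfun => x; rewrite id_lfunE. Qed.

Lemma bij_lfun_comp f g : bijective f -> bijective g -> bijective (f \o g)%VF.
Proof.
move=> bf bg; apply: (eq_bij (bij_comp bf bg)) => x.
by rewrite lfunE.
Qed.

Lemma bij_lfunV f : bijective f -> bijective f^-1%VF.
Proof. by move=> bf; exists f; [exact: bij_lfunVK|exact: bij_lfunK]. Qed.

End Lfun.

(* GL(V, v) with the product f * g = f \o g. *)
Section Stabilizer.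
Variables (F : fieldType) (V : vectType F) (v : V).

Record GLstab := MkGLstab {
  GLstab_val :> 'End(V);
  _ : `[< bijective GLstab_val /\ GLstab_val v = v >] }.

HB.instance Definition _ := [isSub for GLstab_val].
HB.instance Definition _ := [Choice of GLstab by <:].

Lemma GLstab_bij (f : GLstab) : bijective f.
Proof. by case: f => f /= /asboolP[]. Qed.

Lemma GLstab_fix (f : GLstab) : f v = v.
Proof. by case: f => f /= /asboolP[]. Qed.

Fact GLstab1_subproof : `[< bijective (\1%VF : 'End(V)) /\ (\1%VF : 'End(V)) v = v >].
Proof. by apply/asboolP; split; [exact: bij_lfun1|rewrite id_lfunE]. Qed.

Fact GLstabM_subproof (f g : GLstab) :
  `[< bijective (f \o g)%VF /\ (f \o g)%VF v = v >].
Proof.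
apply/asboolP; split; first by apply: bij_lfun_comp; exact: GLstab_bij.
by rewrite lfunE /= !GLstab_fix.
Qed.

Fact GLstabV_subproof (f : GLstab) : `[< bijective (f^-1)%VF /\ (f^-1)%VF v = v >].
Proof.
apply/asboolP; split; first by apply: bij_lfunV; exact: GLstab_bij.
by rewrite -{1}(GLstab_fix f) bij_lfunK//; exact: GLstab_bij.
Qed.

Definition GLstab1 := MkGLstab GLstab1_subproof.
Definition GLstabM f g := MkGLstab (GLstabM_subproof f g).
Definition GLstabV f := MkGLstab (GLstabV_subproof f).

Fact GLstabA : associative GLstabM.
Proof. by move=> f g h; apply: val_inj; rewrite /= comp_lfunA. Qed.
Fact GLstab1M : left_id GLstab1 GLstabM.
Proof. by move=> f; apply: val_inj; rewrite /= comp_lfun1l. Qed.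
Fact GLstabM1 : right_id GLstab1 GLstabM.
Proof. by move=> f; apply: val_inj; rewrite /= comp_lfun1r. Qed.
Fact GLstabVM : left_inverse GLstab1 GLstabV GLstabM.
Proof.
move=> f; apply: val_inj => /=; apply/lker0_compVf/bij_lker0; exact: GLstab_bij.
Qed.
Fact GLstabMV : right_inverse GLstab1 GLstabV GLstabM.
Proof.
move=> f; apply: val_inj => /=; apply/lker0_compfV/bij_lker0; exact: GLstab_bij.
Qed.

HB.instance Definition _ :=
  isGroup.Build GLstab GLstabA GLstab1M GLstabM1 GLstabVM GLstabMV.

End Stabilizer.

(* The automorphism group of the algebra with underlying space U and product
   mul (no associativity or unit is assumed); the group law is composition. *)
Section AlgAut.
Variables (F : fieldType) (U : vectType F) (mul : U -> U -> U).

Definition is_alg_aut (g : 'End(U)) : Prop :=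
  bijective g /\ {morph g : x y / mul x y}.

Record alg_aut := MkAlgAut {
  alg_aut_val :> 'End(U);
  _ : `[< is_alg_aut alg_aut_val >] }.

HB.instance Definition _ := [isSub for alg_aut_val].
HB.instance Definition _ := [Choice of alg_aut by <:].

Lemma alg_autP (g : alg_aut) : is_alg_aut g.
Proof. by case: g => g /= /asboolP. Qed.

Lemma alg_aut_bij (g : alg_aut) : bijective g.
Proof. by case: (alg_autP g). Qed.

Fact alg_aut1_subproof : `[< is_alg_aut \1%VF >].
Proof. by apply/asboolP; split; [exact: bij_lfun1|move=> x y; rewrite !id_lfunE]. Qed.

Fact alg_autM_subproof (f g : alg_aut) : `[< is_alg_aut (f \o g)%VF >].
Proof.
apply/asboolP; split; first by apply: bij_lfun_comp; exact: alg_aut_bij.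
move=> x y; rewrite !lfunE /=.
by rewrite (alg_autP g).2 (alg_autP f).2.
Qed.

Fact alg_autV_subproof (f : alg_aut) : `[< is_alg_aut (f^-1)%VF >].
Proof.
have bf := alg_aut_bij f.
apply/asboolP; split; first exact: bij_lfunV.
move=> x y; apply: (bij_inj bf).
by rewrite (alg_autP f).2 !bij_lfunVK.
Qed.

Definition alg_aut1 := MkAlgAut alg_aut1_subproof.
Definition alg_autM f g := MkAlgAut (alg_autM_subproof f g).
Definition alg_autV f := MkAlgAut (alg_autV_subproof f).

Fact alg_autA : associative alg_autM.
Proof. by move=> f g h; apply: val_inj; rewrite /= comp_lfunA. Qed.
Fact alg_aut1M : left_id alg_aut1 alg_autM.
Proof. by move=> f; apply: val_inj; rewrite /= comp_lfun1l. Qed.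
Fact alg_autM1 : right_id alg_aut1 alg_autM.
Proof. by move=> f; apply: val_inj; rewrite /= comp_lfun1r. Qed.
Fact alg_autVM : left_inverse alg_aut1 alg_autV alg_autM.
Proof.
move=> f; apply: val_inj => /=; apply/lker0_compVf/bij_lker0; exact: alg_aut_bij.
Qed.
Fact alg_autMV : right_inverse alg_aut1 alg_autV alg_autM.
Proof.
move=> f; apply: val_inj => /=; apply/lker0_compfV/bij_lker0; exact: alg_aut_bij.
Qed.

HB.instance Definition _ :=
  isGroup.Build alg_aut alg_autA alg_aut1M alg_autM1 alg_autVM alg_autMV.

End AlgAut.

Section Subalgebra.
Variables (F : fieldType) (U : vectType F) (mul : U -> U -> U).
Variable S : {vspace U}.

Definition subalgebra : Prop := forall a b, a \in S -> b \in S -> mul a b \in S.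

(* On a subalgebra S the projection vsproj S acts as the identity, so this is
   the product inherited from U: see sub_mulE. *)
Definition sub_mul (a b : subvs_of S) : subvs_of S :=
  vsproj S (mul (vsval a) (vsval b)).

Lemma sub_mulE : subalgebra ->
  forall a b, vsval (sub_mul a b) = mul (vsval a) (vsval b).
Proof. by move=> hS a b; rewrite vsprojK// hS// subvsP. Qed.

(* Here too the projection is idle as soon as g maps S to itself: see restrE. *)
Definition restr (g : 'End(U)) : 'End(subvs_of S) :=
  linfun (vsproj S \o (g \o vsval)).

Lemma restrE (g : 'End(U)) : (g @: S)%VS = S ->
  forall a, vsval (restr g a) = g (vsval a).
Proof.
by move=> gS a; rewrite lfunE /= vsprojK// -{2}gS memv_img// subvsP.
Qed.

Lemma restr_alg_aut (g : 'End(U)) : subalgebra -> (g @: S)%VS = S ->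
  is_alg_aut mul g -> is_alg_aut sub_mul (restr g).
Proof.
move=> hS gS [bg mg]; split.
  apply/lker0_bij/lker0P => a b /(congr1 vsval).
  by rewrite !restrE// => /(bij_inj bg) /subvs_inj.
by move=> a b; apply: subvs_inj; rewrite restrE// !sub_mulE// mg !restrE.
Qed.

(* Restriction to S of an action phi of G by automorphisms stabilizing S. *)
Variables (G : groupType) (phi : {multiplicative G -> alg_aut mul}).
Hypothesis hS : subalgebra.
Hypothesis phiS : forall x, (phi x @: S)%VS = S.

Fact restr_hom_subproof x : `[< is_alg_aut sub_mul (restr (phi x)) >].
Proof. by apply/asboolP/restr_alg_aut => //; exact: alg_autP. Qed.

Definition restr_hom (x : G) : alg_aut sub_mul := MkAlgAut (restr_hom_subproof x).

Lemma restr_homE x a : vsval (restr_hom x a) = phi x (vsval a).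
Proof. by rewrite restrE. Qed.

Fact restr_hom_multiplicative : {morph restr_hom : x y / (x * y)%g}.
Proof.
move=> x y; apply: val_inj; apply/lfunP => a; apply: subvs_inj.
have -> : val (restr_hom x * restr_hom y)%g a = restr_hom x (restr_hom y a).
  by rewrite /= lfunE.
by rewrite !restr_homE gmulfM /= lfunE.
Qed.

HB.instance Definition _ :=
  isMultiplicative.Build G (alg_aut sub_mul) restr_hom restr_hom_multiplicative.

End Subalgebra.

(* Bilinear maps V x V -> V as curried linear maps; for dim V = 2 this is the
   underlying vector space of W(2). *)
Notation bilin V := 'Hom(V, 'Hom(V, V)).

Section Bilin.
Variables (F : fieldType) (V : vectType F).
Implicit Types (A B : bilin V) (x y : V).

(* linfun returns an arbitrary linear map on nonlinear input: mk_bilin f is f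
   when f is bilinear (mk_bilinE). *)
Definition mk_bilin (f : V -> V -> V) : bilin V :=
  linfun (fun x => linfun (f x)).

Lemma mk_bilinE (f : V -> V -> V) :
  (forall x, linear (f x)) -> (forall y, linear (f^~ y)) ->
  forall x y, mk_bilin f x y = f x y.
Proof.
move=> lr ll.
have lE x y : linfun (f x) y = f x y.
  pose Lm := GRing.isLinear.Build F V V *:%R (f x) (lr x).
  pose L : {linear V -> V} := HB.pack (f x) Lm.
  exact: (lfunE L).
have lin : linear (fun x => linfun (f x)).
  move=> a x x'; apply/lfunP => y.
  by rewrite add_lfunE scale_lfunE !lE ll.
pose Lm := GRing.isLinear.Build F V 'Hom(V, V) *:%R (fun x => linfun (f x)) lin.
pose L : {linear V -> 'Hom(V, V)} := HB.pack (fun x => linfun (f x)) Lm.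
by move=> x y; rewrite /mk_bilin (lfunE L) /= lE.
Qed.

Lemma bilinP A B : (forall x y, A x y = B x y) -> A = B.
Proof. by move=> AB; apply/lfunP => x; apply/lfunP => y. Qed.

Lemma bilinDl A a x y z : A (a *: x + y) z = a *: A x z + A y z.
Proof. by rewrite linearP add_lfunE scale_lfunE. Qed.

Lemma bilinDr A a x y z : A x (a *: y + z) = a *: A x y + A x z.
Proof. exact: linearP. Qed.

Definition bmul (v : V) A B : bilin V := mk_bilin (fun x y =>
  A v (B x y) - B (A v x) y - B x (A v y)).

Lemma bmulE v A B x y :
  bmul v A B x y = A v (B x y) - B (A v x) y - B x (A v y).
Proof.
have sub3 (p q r p' q' r' : V) :
    (p + p') - (q + q') - (r + r') = (p - q - r) + (p' - q' - r').
  by rewrite !opprD (addrACA p) (addrACA (p - q)).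
by rewrite mk_bilinE // => z a s t; rewrite !(bilinDr, bilinDl) !scalerBr sub3.
Qed.

(* For bijective f, f^-1%VF is the two-sided inverse (bij_lfunK, bij_lfunVK). *)
Definition conj_bilin (f : 'End(V)) A : bilin V := mk_bilin (fun x y =>
  f (A (f^-1%VF x) (f^-1%VF y))).

Lemma conj_bilinE f A x y :
  conj_bilin f A x y = f (A (f^-1%VF x) (f^-1%VF y)).
Proof.
by rewrite mk_bilinE // => z a s t; rewrite !linearP //= add_lfunE scale_lfunE linearP.
Qed.

Fact conj_bilin_linear f : linear (conj_bilin f).
Proof.
move=> a A B; apply: bilinP => x y.
rewrite conj_bilinE !add_lfunE !scale_lfunE linearP /=.
by rewrite !conj_bilinE.
Qed.

HB.instance Definition _ f :=
  GRing.isLinear.Build F (bilin V) (bilin V) *:%R (conj_bilin f)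
    (conj_bilin_linear f).

Section Phi.
Variable v : V.

Fact Phi_subproof (f : GLstab v) :
  `[< is_alg_aut (bmul v) (linfun (conj_bilin f)) >].
Proof.
have fK := bij_lfunK (GLstab_bij f); have fVK := bij_lfunVK (GLstab_bij f).
have fV : f^-1%VF v = v by apply: (bij_inj (GLstab_bij f)); rewrite fVK GLstab_fix.
apply/asboolP; split.
  apply/lker0_bij/lker0P => A B; rewrite !lfunE /= => AB.
  apply: bilinP => x y; have := congr1 (fun C : bilin V => C (f x) (f y)) AB.
  by rewrite !conj_bilinE !fK => /(bij_inj (GLstab_bij f)).
move=> A B; rewrite !lfunE /=; apply: bilinP => x y.
by rewrite conj_bilinE !bmulE !conj_bilinE !linearB /= fV !fK.
Qed.

Definition Phi (f : GLstab v) : alg_aut (bmul v) := MkAlgAut (Phi_subproof f).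

Lemma PhiE (f : GLstab v) A x y :
  Phi f A x y = f (A (f^-1%VF x) (f^-1%VF y)).
Proof. by rewrite /= lfunE conj_bilinE. Qed.

Fact Phi_multiplicative : {morph Phi : f g / (f * g)%g}.
Proof.
move=> f g; apply: val_inj; apply/lfunP => A; apply: bilinP => x y.
have fgV z : (f * g)%g^-1%VF z = g^-1%VF (f^-1%VF z).
  apply: (bij_inj (GLstab_bij (f * g)%g)); rewrite bij_lfunVK; last exact: GLstab_bij.
  by rewrite /= lfunE /= !bij_lfunVK//; exact: GLstab_bij.
have -> : val (Phi f * Phi g)%g A = Phi f (Phi g A) by rewrite /= lfunE.
by rewrite !PhiE !fgV /= lfunE.
Qed.

HB.instance Definition _ :=
  isMultiplicative.Build (GLstab v) (alg_aut (bmul v)) Phi Phi_multiplicative.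

End Phi.
End Bilin.

Arguments Phi {F V} v f.
Arguments sub_mul {F U} mul S a b.

Section W2S2.
Variables (F : fieldType) (V : vectType F) (v1 v2 : V).
Implicit Types (A B : bilin V) (x y : V).

Let v := [tuple v1; v2].

(* Indices are shifted: alpha 0 1 0 is $\alpha_{12}^1$, and so on. *)
Definition alpha (i j k : 'I_2) : bilin V := mk_bilin (fun x y =>
  (coord v i x * coord v j y) *: tnth v k).

Definition e1 := alpha 0 0 0 - alpha 0 1 1 - alpha 1 0 1.
Definition e2 := alpha 0 0 1.
Definition e3 := alpha 1 1 1 - alpha 0 1 0 - alpha 1 0 0.
Definition e4 := alpha 1 1 0.
Definition e5 := 2 *: alpha 0 0 0 + alpha 0 1 1 + alpha 1 0 1.
Definition e6 := 2 *: alpha 1 1 1 + alpha 0 1 0 + alpha 1 0 0.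

Definition W2 : {vspace bilin V} := <<[:: e1; e2; e3; e4; e5; e6]>>%VS.
Definition S2 : {vspace bilin V} := <<[:: e1; e2; e3; e4]>>%VS.

Lemma alphaE_coord i j k x y :
  alpha i j k x y = (coord v i x * coord v j y) *: tnth v k.
Proof.
rewrite mk_bilinE // => z a s t; rewrite linearP /= scalerA -scalerDl;
  congr (_ *: _); ring.
Qed.

Hypothesis hv : basis_of fullv [:: v1; v2].

Let cv (i j : 'I_2) : coord v i (tnth v j) = (i == j)%:R.
Proof.
by rewrite (tnth_nth 0) coord_free; [rewrite eq_sym|exact: basis_free hv].
Qed.

Lemma alphaE i j k t l :
  alpha i j k (tnth v t) (tnth v l) = ((i == t)%:R * (j == l)%:R) *: tnth v k.
Proof. by rewrite alphaE_coord !cv. Qed.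

Let decomp x : x = coord v 0 x *: v1 + coord v 1 x *: v2.
Proof.
rewrite {1}(@coord_basis F V fullv 2 v x hv (memvf x)).
by rewrite big_ord_recl big_ord1 [lift _ _](_ : _ = 1)//; exact: val_inj.
Qed.

Let coordP x y : (forall k, coord v k x = coord v k y) -> x = y.
Proof. by move=> h; rewrite (decomp x) (decomp y) !h. Qed.

Let bilin_coordP A B :
  (forall i j k, coord v k (A (tnth v i) (tnth v j))
                 = coord v k (B (tnth v i) (tnth v j))) -> A = B.
Proof.
move=> h; have h' i j := coordP (h i j).
apply: bilinP => x y; rewrite (decomp x) (decomp y).
have := h' 0 0; have := h' 0 1; have := h' 1 0; have := h' 1 1.
rewrite !(tnth_nth 0) /= => E1 E2 E3 E4.
by rewrite !linearD !linearZ /= !add_lfunE !scale_lfunE E1 E2 E3 E4.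
Qed.

Let c A i j k := coord v k (A (tnth v i) (tnth v j)).

Let cD A B i j k : c (A + B) i j k = c A i j k + c B i j k.
Proof. by rewrite /c !add_lfunE linearD. Qed.
Let cN A i j k : c (- A) i j k = - c A i j k.
Proof. by rewrite /c !opp_lfunE linearN. Qed.
Let cZ a A i j k : c (a *: A) i j k = a * c A i j k.
Proof. by rewrite /c !scale_lfunE linearZ. Qed.
Let calpha i j k i' j' k' :
  c (alpha i j k) i' j' k' = (i == i')%:R * (j == j')%:R * (k' == k)%:R.
Proof. by rewrite /c alphaE linearZ /= cv. Qed.
Let cE := (cD, cN, cZ, calpha).

Let ord2P (P : 'I_2 -> Prop) : P 0 -> P 1 -> forall i, P i.
Proof.
move=> P0 P1 [[|[|//]] hi].
  by have -> : Ordinal hi = 0 by exact: val_inj.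
by have -> : Ordinal hi = 1 by exact: val_inj.
Qed.

Let trace (f : 'End(V)) := coord v 0 (f v1) + coord v 1 (f v2).

Let trace_comp (f g : 'End(V)) : trace (f \o g)%VF = trace (g \o f)%VF.
Proof.
rewrite /trace !lfunE /=.
rewrite (decomp (g v1)) (decomp (g v2)) (decomp (f v1)) (decomp (f v2)).
rewrite !linearD !linearZ /=; ring.
Qed.

Let trace_conj (f g : 'End(V)) : bijective f ->
  trace (f \o g \o f^-1)%VF = trace g.
Proof.
move=> /bij_lker0 kf.
by rewrite trace_comp comp_lfunA lker0_compVf// comp_lfun1l.
Qed.

Let symmetric_bilin A := forall x y, A x y = A y x.

Let symP A : (forall k, c A 0 1 k = c A 1 0 k) -> symmetric_bilin A.
Proof.
move=> h x y.
have {}h : A v1 v2 = A v2 v1.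
  by apply: coordP => k; have := h k; rewrite /c !(tnth_nth 0).
rewrite (decomp x) (decomp y) !linearD !linearZ /= !add_lfunE !scale_lfunE h.
rewrite !scalerDr !scalerA !(mulrC (coord v _ y)) -!addrA.
by congr (_ + _); rewrite addrCA.
Qed.

Let sym_c A : symmetric_bilin A -> forall k, c A 1 0 k = c A 0 1 k.
Proof. by move=> h k; rewrite /c h. Qed.

Let W2_sym A : A \in W2 -> symmetric_bilin A.
Proof.
move=> /(@coord_span _ _ _ (in_tuple _)) ->; apply: symP.
rewrite !big_ord_recl big_ord0 /= /e1 /e2 /e3 /e4 /e5 /e6.
apply: ord2P; rewrite addr0 !cE !eqxx /=; ring.
Qed.

Let sym_W2 A : 3 != 0 :> F -> symmetric_bilin A -> A \in W2.
Proof.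
move=> n3 sA; pose w := W2.
have e1W : e1 \in w by rewrite memv_span// !inE eqxx ?orbT.
have e2W : e2 \in w by rewrite memv_span// !inE eqxx ?orbT.
have e3W : e3 \in w by rewrite memv_span// !inE eqxx ?orbT.
have e4W : e4 \in w by rewrite memv_span// !inE eqxx ?orbT.
have e5W : e5 \in w by rewrite memv_span// !inE eqxx ?orbT.
have e6W : e6 \in w by rewrite memv_span// !inE eqxx ?orbT.
have -> : A = ((c A 0 0 0 - 2 * c A 0 1 1) / 3) *: e1 + c A 0 0 1 *: e2
  + ((c A 1 1 1 - 2 * c A 0 1 0) / 3) *: e3 + c A 1 1 0 *: e4
  + ((c A 0 0 0 + c A 0 1 1) / 3) *: e5 + ((c A 1 1 1 + c A 0 1 0) / 3) *: e6.
  apply: bilin_coordP; rewrite -/(c _ _ _ _) /e1 /e2 /e3 /e4 /e5 /e6.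
  have sc := sym_c sA.
  by do 3!apply: ord2P; rewrite -![coord _ _ _]/(c _ _ _ _) ?sc !cE /=; field.
by rewrite !rpredD// rpredZ.
Qed.

Let S2_W2 A : A \in S2 -> A \in W2.
Proof.
apply/subvP/sub_span => B; rewrite !inE.
by move=> /or4P[] /eqP ->; rewrite eqxx ?orbT.
Qed.

Let traceP A : (forall x, trace (A x) = 0) <->
  (c A 0 0 0 + c A 0 1 1 = 0 /\ c A 1 0 0 + c A 1 1 1 = 0).
Proof.
split=> [h|[h1 h2] x].
  by split; [have := h v1|have := h v2]; rewrite /trace /c !(tnth_nth 0).
rewrite /trace (decomp x) !linearD !linearZ /= !add_lfunE !scale_lfunE.
rewrite !linearD !linearZ /=; move: h1 h2; rewrite /c !(tnth_nth 0) /= => h1 h2.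
by rewrite addrACA -!mulrDr h1 h2 !mulr0 addr0.
Qed.

Let S2_trace A : A \in S2 -> forall x, trace (A x) = 0.
Proof.
move=> /(@coord_span _ _ _ (in_tuple _)) ->; apply/traceP.
rewrite !big_ord_recl big_ord0 /= /e1 /e2 /e3 /e4.
by split; rewrite addr0 !cE !eqxx /=; ring.
Qed.

Let trace_S2 A : symmetric_bilin A -> (forall x, trace (A x) = 0) -> A \in S2.
Proof.
move=> sA /traceP[t1 t2]; pose w := S2.
have e1W : e1 \in w by rewrite memv_span// !inE eqxx ?orbT.
have e2W : e2 \in w by rewrite memv_span// !inE eqxx ?orbT.
have e3W : e3 \in w by rewrite memv_span// !inE eqxx ?orbT.
have e4W : e4 \in w by rewrite memv_span// !inE eqxx ?orbT.
have sc := sym_c sA.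
have {}t1 : c A 0 1 1 = - c A 0 0 0 by apply/eqP; rewrite -addr_eq0 addrC t1.
have {}t2 : c A 0 1 0 = - c A 1 1 1 by apply/eqP; rewrite -addr_eq0 -sc t2.
have -> : A = c A 0 0 0 *: e1 + c A 0 0 1 *: e2 + c A 1 1 1 *: e3
  + c A 1 1 0 *: e4.
  apply: bilin_coordP; rewrite /e1 /e2 /e3 /e4.
  by do 3!apply: ord2P; rewrite -![coord _ _ _]/(c _ _ _ _) ?sc !cE /= ?t1 ?t2; ring.
by rewrite !rpredD// rpredZ.
Qed.

Let bmul_sym A B : symmetric_bilin B -> symmetric_bilin (bmul v1 A B).
Proof.
move=> sB x y; rewrite !bmulE (sB x y) (sB x (A v1 y)) (sB (A v1 x)).
by rewrite addrAC.
Qed.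

Let conj_sym f A : symmetric_bilin A -> symmetric_bilin (conj_bilin f A).
Proof. by move=> sA x y; rewrite !conj_bilinE sA. Qed.

Lemma S2_subalgebra : subalgebra (bmul v1) S2.
Proof.
move=> A B _ BS; apply: trace_S2; first exact/bmul_sym/W2_sym/S2_W2.
move=> x; have tB := S2_trace BS.
have -> : bmul v1 A B x = (A v1 \o B x)%VF - B (A v1 x) - (B x \o A v1)%VF.
  by apply/lfunP => y; rewrite bmulE !add_lfunE !opp_lfunE !lfunE.
have tD (f g : 'End(V)) : trace (f - g) = trace f - trace g.
  by rewrite /trace !add_lfunE !opp_lfunE !linearB /=; ring.
by rewrite !tD trace_comp tB subr0 subrr.
Qed.

Let stab_eq (f : GLstab v1) (S : {vspace bilin V}) :
  (forall A, A \in S -> conj_bilin f A \in S) -> (Phi v1 f @: S)%VS = S.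
Proof.
move=> h; apply/eqP; rewrite eqEdim; apply/andP; split.
  by apply/subvP => _ /memv_imgP[A AS ->]; rewrite /= lfunE h.
rewrite limg_dim_eq //.
by have /bij_lker0/eqP -> := alg_aut_bij (Phi v1 f); rewrite capv0.
Qed.

Lemma Phi_S2 (f : GLstab v1) : (Phi v1 f @: S2)%VS = S2.
Proof.
apply: stab_eq => A AS; apply: trace_S2; first exact/conj_sym/W2_sym/S2_W2.
move=> x.
have -> : conj_bilin f A x = (f \o A (f^-1%VF x) \o f^-1)%VF.
  by apply/lfunP => y; rewrite conj_bilinE !lfunE /= lfunE.
by rewrite trace_conj ?S2_trace//; exact: GLstab_bij.
Qed.

Definition Phi_on_S2 : GLstab v1 -> alg_aut (sub_mul (bmul v1) S2) :=
  restr_hom (phi := Phi v1) S2_subalgebra Phi_S2.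
HB.instance Definition _ :=
  Multiplicative.copy Phi_on_S2 (restr_hom (phi := Phi v1) S2_subalgebra Phi_S2).

Lemma Phi_on_S2E f a : vsval (Phi_on_S2 f a) = Phi v1 f (vsval a).
Proof. exact: restr_homE. Qed.

Lemma S2_basis : basis_of S2 [:: e1; e2; e3; e4].
Proof.
rewrite /basis_of eqxx /=.
apply/(@freeP _ _ _ [tuple e1; e2; e3; e4]) => a.
rewrite !big_ord_recl big_ord0 /= addr0.
set a0 := a _; set a1 := a _; set a2 := a _; set a3 := a _ => h.
have {}h i j k : c (a0 *: e1 + (a1 *: e2 + (a2 *: e3 + a3 *: e4))) i j k = 0.
  by rewrite h /c !zero_lfunE linear0.
rewrite /e1 /e2 /e3 /e4 in h.
have z0 : a0 = 0 by rewrite -(h 0 0 0) !cE /=; ring.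
have z1 : a1 = 0 by rewrite -(h 0 0 1) !cE /=; ring.
have z2 : a2 = 0 by rewrite -(h 1 1 1) !cE /=; ring.
have z3 : a3 = 0 by rewrite -(h 1 1 0) !cE /=; ring.
case=> [[|[|[|[|//]]]] hi]; [rewrite -[RHS]z0|rewrite -[RHS]z1
  |rewrite -[RHS]z2|rewrite -[RHS]z3]; congr (a _); exact: val_inj.
Qed.

Hypothesis hF : [pchar F] =i pred0.

Let n3 : 3 != 0 :> F.
Proof. by move/pcharf0P: hF => ->. Qed.

Lemma W2_basis : basis_of W2 [:: e1; e2; e3; e4; e5; e6].
Proof.
rewrite /basis_of eqxx /=.
apply/(@freeP _ _ _ [tuple e1; e2; e3; e4; e5; e6]) => a.
rewrite !big_ord_recl big_ord0 /= addr0.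
set a0 := a _; set a1 := a _; set a2 := a _; set a3 := a _.
set a4 := a _; set a5 := a _ => h.
have {}h i j k : c (a0 *: e1 + (a1 *: e2 + (a2 *: e3 + (a3 *: e4
    + (a4 *: e5 + a5 *: e6))))) i j k = 0.
  by rewrite h /c !zero_lfunE linear0.
rewrite /e1 /e2 /e3 /e4 /e5 /e6 in h.
have z4 : a4 = 0.
  apply: (mulfI n3); rewrite mulr0 -[RHS](addr0 0).
  by rewrite -{1}(h 0 0 0) -(h 0 1 1) !cE /=; ring.
have z5 : a5 = 0.
  apply: (mulfI n3); rewrite mulr0 -[RHS](addr0 0).
  by rewrite -{1}(h 1 1 1) -(h 0 1 0) !cE /=; ring.
have z0 : a0 = 0 by rewrite -(h 0 0 0) !cE z4 z5 /=; ring.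
have z1 : a1 = 0 by rewrite -(h 0 0 1) !cE z4 z5 /=; ring.
have z2 : a2 = 0 by rewrite -(h 1 1 1) !cE z4 z5 /=; ring.
have z3 : a3 = 0 by rewrite -(h 1 1 0) !cE z4 z5 /=; ring.
case=> [[|[|[|[|[|[|//]]]]]] hi]; [rewrite -[RHS]z0|rewrite -[RHS]z1
  |rewrite -[RHS]z2|rewrite -[RHS]z3|rewrite -[RHS]z4|rewrite -[RHS]z5];
  congr (a _); exact: val_inj.
Qed.

Lemma W2_subalgebra : subalgebra (bmul v1) W2.
Proof. by move=> A B _ BS; apply: sym_W2 => //; exact/bmul_sym/W2_sym. Qed.

Lemma Phi_W2 (f : GLstab v1) : (Phi v1 f @: W2)%VS = W2.
Proof.
by apply: stab_eq => A AS; apply: sym_W2 => //; exact/conj_sym/W2_sym.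
Qed.

Definition Phi_on_W2 : GLstab v1 -> alg_aut (sub_mul (bmul v1) W2) :=
  restr_hom (phi := Phi v1) W2_subalgebra Phi_W2.
HB.instance Definition _ :=
  Multiplicative.copy Phi_on_W2 (restr_hom (phi := Phi v1) W2_subalgebra Phi_W2).

Lemma Phi_on_W2E f a : vsval (Phi_on_W2 f a) = Phi v1 f (vsval a).
Proof. exact: restr_homE. Qed.

End W2S2.

Section AffineGroup.
Variable F : fieldType.

Definition is_affine_mx (M : 'M[F]_2) : bool :=
  [&& M 0 0 == 1, M 1 0 == 0 & M 1 1 != 0].

Record affine_mx := MkAffineMx {
  affine_mx_val :> 'M[F]_2;
  _ : is_affine_mx affine_mx_val }.

HB.instance Definition _ := [isSub for affine_mx_val].
HB.instance Definition _ := [Choice of affine_mx by <:].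

Lemma affine_mxP (M : affine_mx) : [/\ M 0 0 = 1, M 1 0 = 0 & M 1 1 != 0].
Proof. by case: M => M /= /and3P[/eqP ? /eqP ? ?]. Qed.

Fact affine_mx1_subproof : is_affine_mx 1%:M.
Proof. by rewrite /is_affine_mx !mxE /= !eqxx oner_neq0. Qed.

Fact affine_mxM_subproof (M N : affine_mx) : is_affine_mx (M *m N).
Proof.
have [M0 M1 M2] := affine_mxP M; have [N0 N1 N2] := affine_mxP N.
rewrite /is_affine_mx !mxE !big_ord_recl !big_ord0.
rewrite [lift _ _](_ : _ = 1); last exact: val_inj.
by rewrite M0 M1 N0 N1 !(mul0r, mulr0, mul1r, addr0, add0r) !eqxx mulf_neq0.
Qed.

Lemma affine_mx_unit (M : affine_mx) : val M \in unitmx.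
Proof.
have [M0 M1 M2] := affine_mxP M.
rewrite unitmxE -det_tr det_trig; last first.
  apply/is_trig_mxP => -[[|[|//]] hi] [[|[|//]] hj] //= _.
  by rewrite mxE -[RHS]M1; congr (val M _ _); exact: val_inj.
rewrite !big_ord_recl big_ord0 !mxE mulr1.
by rewrite [lift _ _](_ : _ = 1) ?M0 ?mul1r ?unitfE//; exact: val_inj.
Qed.

Fact affine_mxV_subproof (M : affine_mx) : is_affine_mx (invmx M).
Proof.
have [M0 M1 M2] := affine_mxP M; have uM := affine_mx_unit M.
have E i : (invmx M *m M) i 0 = invmx M i 0.
  rewrite mxE !big_ord_recl big_ord0 M0 mulr1.
  by rewrite [lift _ _](_ : _ = 1) ?M1 ?mulr0 ?addr0//; exact: val_inj.
have E0 := E 0; have E1 := E 1; rewrite mulVmx// !mxE /= in E0 E1.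
rewrite /is_affine_mx -E0 -E1 !eqxx /=.
have : (invmx M *m M) 1 1 = 1 by rewrite mulVmx// mxE.
rewrite mxE !big_ord_recl big_ord0 -E1 mul0r add0r addr0.
rewrite [lift _ _](_ : _ = 1); last exact: val_inj.
by move=> h; apply: contra_eqN h => /eqP ->; rewrite mul0r eq_sym oner_neq0.
Qed.

Definition affine_mx1 := MkAffineMx affine_mx1_subproof.
Definition affine_mxM M N := MkAffineMx (affine_mxM_subproof M N).
Definition affine_mxV M := MkAffineMx (affine_mxV_subproof M).

Fact affine_mxA : associative affine_mxM.
Proof. by move=> L M N; apply: val_inj; rewrite /= mulmxA. Qed.
Fact affine_mx1M : left_id affine_mx1 affine_mxM.
Proof. by move=> M; apply: val_inj; rewrite /= mul1mx. Qed.
Fact affine_mxM1 : right_id affine_mx1 affine_mxM.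
Proof. by move=> M; apply: val_inj; rewrite /= mulmx1. Qed.
Fact affine_mxVM : left_inverse affine_mx1 affine_mxV affine_mxM.
Proof. by move=> M; apply: val_inj; rewrite /= mulVmx// affine_mx_unit. Qed.
Fact affine_mxMV : right_inverse affine_mx1 affine_mxV affine_mxM.
Proof. by move=> M; apply: val_inj; rewrite /= mulmxV// affine_mx_unit. Qed.

HB.instance Definition _ :=
  isGroup.Build affine_mx affine_mxA affine_mx1M affine_mxM1 affine_mxVM affine_mxMV.

End AffineGroup.

(* Main.v *)
(* In all three algebras A ** B is the natural action on B of the endomorphism
   A(v1, .), so the left multiplications by e1, e2, e3, e4 are those of H, F, -E
   and 0 for the standard basis E, F, H of sl_2.
   Let G be an automorphism of a subalgebra U containing S2.  The element
   B = G e4 acts by zero, while G e1 ** B = 3 B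
   and G e3 ** B = 0; evaluated at v1 this makes the endomorphisms of G e1 and G e3
   upper triangular, and the relations between e1 and e3 then force that of G e1
   to be [[1, q], [0, -1]].  The vector w = (G e2)(v1, v1) spans its eigenline
   for -1, so f : v1 |-> v1, v2 |-> w lies in GL(V, v1), and h = Phi(f)^-1 G
   fixes the endomorphism of e1 and the value of e2 at (v1, v1).  Comparing
   weights, h fixes e2 and scales e4, and e2 ** e4 = e3, e2 ** e3 = 2 e1 show
   that h is the identity on S2.  Since A ** e2 and A ** e4 lie in S2 and
   determine A(v1, .), h preserves A(v1, .) for every A in U; applied to e2 ** B
   this gives (h B)(v2, .) = B(v2, .), so h is the identity on U. *)
Require Import Defs.
From HB Require Import structures.
From mathcomp Require Import all_boot all_order all_algebra.
From mathcomp Require Import boolp ring.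

Set Implicit Arguments.
Unset Strict Implicit.
Unset Printing Implicit Defensive.

Import GRing.Theory.
Local Open Scope ring_scope.

(** * General facts on equations, bijections and groups *)

(** Deduces one linear equation from another by naming the multiplier [c]; the remaining identity is
    left to [ring]. *)
Lemma eq_lincomb (R : comPzRingType) (c a b x y : R) :
  a = b -> x - y = c * (a - b) -> x = y.
Proof. by move=> ->; rewrite subrr mulr0 => /subr0_eq. Qed.

Lemma inj_surj_bij (T : choiceType) (T' : eqType) (phi : T -> T') :
  injective phi -> (forall y, exists x, phi x = y) -> bijective phi.
Proof.
move=> phiI phiS.
have ex y : exists x, phi x == y by have [x <-] := phiS y; exists x.
have phiK y : phi (xchoose (ex y)) = y by apply/eqP/(xchooseP (ex y)).
by exists (fun y => xchoose (ex y)) => // x; exact/phiI/phiK.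
Qed.

(** The isomorphism is [psi] after the inverse of [phi]; it compares two automorphism groups through
    GL(V, v1). *)
Lemma group_isomorphic_cancel (G H K : groupType)
    (phi : {multiplicative G -> H}) (psi : {multiplicative G -> K}) :
  bijective phi -> bijective psi -> group_isomorphic H K.
Proof.
move=> [phi' phiK phi'K] psi_bij.
have phi'M : {morph phi' : x y / (x * y)%g}.
  by move=> x y; apply: (can_inj phiK); rewrite gmulfM !phi'K.
have chiM : {morph psi \o phi' : x y / (x * y)%g}.
  by move=> x y; rewrite /= phi'M gmulfM.
pose chi_mult := isMultiplicative.Build H K (psi \o phi') chiM.
pose chi : {multiplicative H -> K} := HB.pack (psi \o phi') chi_mult.
exists chi; apply: bij_comp psi_bij _; by exists phi.
Qed.

Lemma ord2P (P : 'I_2 -> Prop) : P 0 -> P 1 -> forall i, P i.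
Proof.
move=> P0 P1 [[|[|//]] hi].
  by have -> : Ordinal hi = 0 by exact: val_inj.
by have -> : Ordinal hi = 1 by exact: val_inj.
Qed.

(** * Coordinates and structure constants *)

Section Automorphisms.
Variables (F : fieldType) (V : vectType F) (v1 v2 : V).
Hypothesis hv : basis_of fullv [:: v1; v2].
Implicit Types A B : bilin V.

Notation v := [tuple v1; v2].
Notation e1 := (e1 v1 v2).
Notation e2 := (e2 v1 v2).
Notation e3 := (e3 v1 v2).
Notation e4 := (e4 v1 v2).
Notation "A ** B" := (bmul v1 A B) (at level 40, left associativity).

Lemma coord_basis2 (i j : 'I_2) : coord v i (tnth v j) = (i == j)%:R.
Proof.
by rewrite (tnth_nth 0) coord_free; [rewrite eq_sym|exact: basis_free hv].
Qed.

Lemma coord_v1 i : coord v i v1 = (i == 0)%:R.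
Proof. exact: (coord_basis2 i 0). Qed.
Lemma coord_v2 i : coord v i v2 = (i == 1)%:R.
Proof. exact: (coord_basis2 i 1). Qed.

Lemma basis2_decomp x : x = coord v 0 x *: v1 + coord v 1 x *: v2.
Proof.
rewrite {1}(@coord_basis F V fullv 2 v x hv (memvf x)).
by rewrite big_ord_recl big_ord1 [lift _ _](_ : _ = 1)//; exact: val_inj.
Qed.

Lemma coord2_inj x y : (forall k, coord v k x = coord v k y) -> x = y.
Proof. by move=> h; rewrite (basis2_decomp x) (basis2_decomp y) !h. Qed.

Lemma lfun_eq2 (U : vectType F) (f g : 'Hom(V, U)) :
  f v1 = g v1 -> f v2 = g v2 -> f = g.
Proof.
move=> h1 h2; apply/lfunP => x.
by rewrite (basis2_decomp x) !linearD !linearZ /= h1 h2.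
Qed.

(** The entries [sc A 0 j k] form the matrix of A(v1, .), with column [j] and row [k]; left
    multiplication by A depends on them alone. *)
Definition sc A i j k := coord v k (A (tnth v i) (tnth v j)).

Lemma scD A B i j k : sc (A + B) i j k = sc A i j k + sc B i j k.
Proof. by rewrite /sc !add_lfunE linearD. Qed.
Lemma scN A i j k : sc (- A) i j k = - sc A i j k.
Proof. by rewrite /sc !opp_lfunE linearN. Qed.
Lemma scZ a A i j k : sc (a *: A) i j k = a * sc A i j k.
Proof. by rewrite /sc !scale_lfunE linearZ. Qed.
Lemma sc0 i j k : sc 0 i j k = 0.
Proof. by rewrite /sc !zero_lfunE linear0. Qed.
Lemma sc_alpha i j k i' j' k' :
  sc (alpha v1 v2 i j k) i' j' k' = (i == i')%:R * (j == j')%:R * (k' == k)%:R.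
Proof. by rewrite /sc alphaE// linearZ /= coord_basis2. Qed.

Lemma sc_inj A B : (forall i j k, sc A i j k = sc B i j k) -> A = B.
Proof.
move=> h; have h' i j := coord2_inj (h i j).
apply: lfun_eq2; apply: lfun_eq2.
- exact: (h' 0 0).
- exact: (h' 0 1).
- exact: (h' 1 0).
- exact: (h' 1 1).
Qed.

Lemma sc_mul A B i j k :
  sc (A ** B) i j k =
    (sc A 0 0 k * sc B i j 0 + sc A 0 1 k * sc B i j 1)
    - (sc A 0 i 0 * sc B 0 j k + sc A 0 i 1 * sc B 1 j k)
    - (sc A 0 j 0 * sc B i 0 k + sc A 0 j 1 * sc B i 1 k).
Proof.
rewrite /sc bmulE !linearB /= !(tnth_nth 0 v 0) !(tnth_nth 0 v 1) /=.
set x := tnth _ i; set y := tnth _ j.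
rewrite {1}(basis2_decomp (B x y)) {1}(basis2_decomp (A v1 x)).
rewrite {1}(basis2_decomp (A v1 y)) !linearD !linearZ /= !add_lfunE !scale_lfunE.
by rewrite !linearD !linearZ /= !(mulrC (coord _ _ (B x y))).
Qed.

(** * Multiplication table of S2 *)

Notation table s := (fun i j k : 'I_2 => nth 0 s (4 * i + 2 * j + k)).

Ltac sc_table := do 3! apply: ord2P;
  rewrite /Defs.e1 /Defs.e2 /Defs.e3 /Defs.e4 !(scD, scN, sc_alpha) /=; ring.

Lemma sc_e1 i j k : sc e1 i j k = table [:: 1; 0; 0; -1; 0; -1; 0; 0] i j k.
Proof. by move: i j k; sc_table. Qed.
Lemma sc_e2 i j k : sc e2 i j k = table [:: 0; 1; 0; 0; 0; 0; 0; 0] i j k.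
Proof. by move: i j k; sc_table. Qed.
Lemma sc_e3 i j k : sc e3 i j k = table [:: 0; 0; -1; 0; -1; 0; 0; 1] i j k.
Proof. by move: i j k; sc_table. Qed.
Lemma sc_e4 i j k : sc e4 i j k = table [:: 0; 0; 0; 0; 0; 0; 1; 0] i j k.
Proof. by move: i j k; sc_table. Qed.

Definition scE := (scD, scN, scZ, sc_mul, sc0, sc_e1, sc_e2, sc_e3, sc_e4).

Ltac sc_ring := apply: sc_inj; do 3! apply: ord2P;
  rewrite !scE /= ?(mul0r, mulr0); ring.

Lemma e1e1 : e1 ** e1 = - e1. Proof. sc_ring. Qed.
Lemma e1e2 : e1 ** e2 = - (3 *: e2). Proof. sc_ring. Qed.
Lemma e1e3 : e1 ** e3 = e3. Proof. sc_ring. Qed.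
Lemma e1e4 : e1 ** e4 = 3 *: e4. Proof. sc_ring. Qed.
Lemma e2e3 : e2 ** e3 = 2 *: e1. Proof. sc_ring. Qed.
Lemma e2e4 : e2 ** e4 = e3. Proof. sc_ring. Qed.
Lemma e3e1 : e3 ** e1 = - (2 *: e3). Proof. sc_ring. Qed.
Lemma e3e4 : e3 ** e4 = 0. Proof. sc_ring. Qed.
Lemma e4M A : e4 ** A = 0. Proof. sc_ring. Qed.

Lemma mul_e2 A :
  A ** e2 = (sc A 0 1 1 - 2 * sc A 0 0 0) *: e2 + sc A 0 1 0 *: e1.
Proof. sc_ring. Qed.

Lemma mul_e4 A :
  A ** e4 = (sc A 0 0 0 - 2 * sc A 0 1 1) *: e4 + sc A 0 0 1 *: e3.
Proof. sc_ring. Qed.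

(** * Recovering A(v1, .) from left multiplication by A *)

Hypothesis hF : [pchar F] =i pred0.

Lemma natf_neq0 n : n.+1%:R != 0 :> F.
Proof. by move/pcharf0P: hF => ->. Qed.

(** The two products display the off-diagonal entries of A(v1, .) and, for its diagonal (a, d), the
    combinations d - 2a and a - 2d. These determine a and d because 3 is invertible. *)
Lemma left_action_inj A A' : A ** e2 = A' ** e2 -> A ** e4 = A' ** e4 ->
  forall j k, sc A 0 j k = sc A' 0 j k.
Proof.
have n3 := natf_neq0 2.
rewrite !mul_e2 !mul_e4 => h2 h4.
have h2E i j k := congr1 (fun B => sc B i j k) h2.
have h4E i j k := congr1 (fun B => sc B i j k) h4.
have r := h2E 0 0 0; have x := h2E 0 0 1; have y := h4E 1 1 0; have q := h4E 1 1 1.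
rewrite !scE /= !(mulr0, mulr1, addr0, add0r) in r x y q.
apply: ord2P; apply: ord2P => //; apply: (mulfI n3).
(* This is 3 [sc B 0 0 0], rewritten in the two combinations equated by [x] and [y]. *)
- pose d B := - (2 * (sc B 0 1 1 - 2 * sc B 0 0 0) + (sc B 0 0 0 - 2 * sc B 0 1 1)).
  by transitivity (d A); [|transitivity (d A'); [rewrite /d x y|]]; rewrite /d; ring.
- pose d B := - (2 * (sc B 0 0 0 - 2 * sc B 0 1 1) + (sc B 0 1 1 - 2 * sc B 0 0 0)).
  by transitivity (d A); [|transitivity (d A'); [rewrite /d x y|]]; rewrite /d; ring.
Qed.

Lemma left_action_eq0 B : B ** e2 = 0 -> B ** e4 = 0 -> forall j k, sc B 0 j k = 0.
Proof.
move=> B2 B4 j k; rewrite -[RHS](sc0 0 j k).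
have M0 X : 0 ** X = 0 :> bilin V by apply: sc_inj => *; rewrite !scE; ring.
by apply: left_action_inj; rewrite M0.
Qed.

(** * Triangular form and weights *)

(** As B(v1, .) = 0, (A ** B)(v1, y) = -B(A(v1, v1), y), which is -[sc A 0 0 1] times B(v2, y), and
    B(v2, .) is nonzero. *)
Lemma left_kernel_stab A B : (forall j k, sc B 0 j k = 0) -> B != 0 ->
  (forall j k, sc (A ** B) 0 j k = 0) -> sc A 0 0 1 = 0.
Proof.
move=> B0 nB AB; apply/eqP; apply: contraNT nB => nA; apply/eqP/sc_inj.
move=> + j k; apply: ord2P; rewrite sc0 //.
have /eqP := AB j k; rewrite !scE !B0 !mulr0 !add0r subr0 oppr_eq0 mulf_eq0.
by rewrite (negPf nA) => /eqP.
Qed.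

Lemma left_kernelM A B : (forall j k, sc A 0 j k = 0) -> A ** B = 0.
Proof. by move=> A0; apply: sc_inj => i j k; rewrite !scE !A0; ring. Qed.

(** A, B, C stand for the images of e1, e4, e3. *)
Lemma upper_triangular A B C :
  (forall j k, sc B 0 j k = 0) -> B != 0 -> C != 0 ->
  A ** B = 3 *: B -> C ** B = 0 ->
  A ** A = - A -> A ** C = C -> C ** A = - (2 *: C) ->
  [/\ sc A 0 0 0 = 1, sc A 0 0 1 = 0 & sc A 0 1 1 = -1].
Proof.
move=> B0 nB nC AB CB AA AC CA.
have n2 := natf_neq0 1; have n3 := natf_neq0 2.
have a01 : sc A 0 0 1 = 0.
  by apply: left_kernel_stab nB _ => // j k; rewrite AB scZ B0 mulr0.
have c01 : sc C 0 0 1 = 0.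
  by apply: left_kernel_stab nB _ => // j k; rewrite CB sc0.
have AAE i j k := congr1 (fun B => sc B i j k) AA.
have ACE i j k := congr1 (fun B => sc B i j k) AC.
(* By [a01], (A ** A)(v1, .) is -[sc A 0 0 0] times A(v1, .), so the entry is 1 or A(v1, .) = 0; the
   latter would give 3 B = A ** B = 0. *)
have a00 : sc A 0 0 0 = 1.
  apply/eqP; rewrite -subr_eq0; apply: contraNT nB => nA.
  have A0 j k : sc A 0 j k = 0.
    apply: (mulfI nA); rewrite mulr0.
    have := AAE 0 j k; move: j k; do 2! apply: ord2P; rewrite !scE ?a01 => h;
      by apply: (eq_lincomb (c := -1) h); ring.
  by have /eqP := left_kernelM B A0; rewrite AB scaler_eq0 (negPf n3).
have c00 : sc C 0 0 0 = 0.
  apply: (mulfI n2); have := ACE 0 0 0; rewrite !scE a00 a01 c01 => h.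
  by apply: (eq_lincomb (c := -1) h); ring.
have c11 : sc C 0 1 1 = 0.
  apply: (mulfI n2); have := ACE 0 1 1; rewrite !scE a00 a01 c01 => h.
  by apply: (eq_lincomb (c := -1) h); ring.
(* The last entry of C(v1, .) is killed by [sc A 0 1 1] + 1. Were this factor nonzero, C(v1, .) = 0
   would give 2 C = -(C ** A) = 0. *)
split => //; apply/eqP; rewrite -subr_eq0 opprK; apply: contraNT nC => nA.
have C0 : forall j k, sc C 0 j k = 0.
  do 2! apply: ord2P => //; apply: (mulfI nA).
  have := ACE 0 1 0; rewrite !scE a00 a01 c00 c11 => h.
  by apply: (eq_lincomb (c := -1) h); ring.
by have /eqP := left_kernelM A C0; rewrite CA oppr_eq0 scaler_eq0 (negPf n2).
Qed.

(** E and B stand for the images of e2 and e4. With w = E(v1, v1), the relation at (v1, v1) reads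
    A(v1, w) - 2w = -3w. If w had no v2-coordinate, the relation would force E(v1, .) = 0, hence E
    ** B = 0. *)
Lemma weight_m3_eigen A B E :
  sc A 0 0 0 = 1 -> sc A 0 0 1 = 0 -> sc A 0 1 1 = -1 ->
  A ** E = - (3 *: E) -> E ** B != 0 ->
  A v1 (E v1 v1) = - E v1 v1 /\ coord v 1 (E v1 v1) != 0.
Proof.
have n2 := natf_neq0 1; have n4 := natf_neq0 3.
move=> a00 a01 a11 AE nE.
have AEE i j k := congr1 (fun B => sc B i j k) AE.
split.
  have Av1 : A v1 v1 = v1.
    apply: coord2_inj => k; rewrite coord_v1.
    by move: k; apply: ord2P; [exact: a00|exact: a01].
  have := congr1 (fun B : bilin V => B v1 v1) AE.
  rewrite bmulE Av1 !opp_lfunE !scale_lfunE scaler_nat => h.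
  apply: (addIr (- E v1 v1)); apply: (addIr (- E v1 v1)); rewrite h.
  by rewrite !mulrS addr0 !opprD addrA.
apply: contraNN nE => /eqP; rewrite -[coord _ _ _]/(sc E 0 0 1) => E001.
have E000 : sc E 0 0 0 = 0.
  apply: (mulfI n2); have := AEE 0 0 0; rewrite !scE a00 a01 E001 => h.
  by apply: (eq_lincomb (c := 1) h); ring.
have E011 : sc E 0 1 1 = 0.
  apply: (mulfI n2); have := AEE 0 1 1; rewrite !scE a00 a01 a11 E001 => h.
  by apply: (eq_lincomb (c := 1) h); ring.
have E010 : sc E 0 1 0 = 0.
  apply: (mulfI n4); have := AEE 0 1 0; rewrite !scE a00 a01 a11 E000 E011 => h.
  by apply: (eq_lincomb (c := 1) h); ring.
by apply/eqP/left_kernelM; do 2! apply: ord2P => //.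
Qed.

(* If A(v1, .) = diag(1, -1), then alpha i j k is an eigenvector of A ** _ for
   w_k - w_i - w_j with w = (1, -1); this is -3 only for (i, j, k) = (0, 0, 1)
   and 3 only for (1, 1, 0). *)
Lemma weight_spaces A :
  sc A 0 0 0 = 1 -> sc A 0 0 1 = 0 -> sc A 0 1 0 = 0 -> sc A 0 1 1 = -1 ->
  (forall E, A ** E = - (3 *: E) -> E = sc E 0 0 1 *: e2) /\
  (forall B, A ** B = 3 *: B -> B = sc B 1 1 0 *: e4).
Proof.
have n2 := natf_neq0 1; have n4 := natf_neq0 3; have n6 := natf_neq0 5.
move=> a00 a01 a10 a11; split=> E AE; apply: sc_inj => i j k.
  have := congr1 (fun B => sc B i j k) AE.
  rewrite !scE; move: i j k; do 3! apply: ord2P; rewrite /= ?a00 ?a01 ?a10 ?a11 => h;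
  by [ring | apply: (mulfI n2); apply: (eq_lincomb (c := 1) h); ring
   | apply: (mulfI n4); apply: (eq_lincomb (c := 1) h); ring
   | apply: (mulfI n6); apply: (eq_lincomb (c := 1) h); ring].
have := congr1 (fun B => sc B i j k) AE.
rewrite !scE; move: i j k; do 3! apply: ord2P; rewrite /= ?a00 ?a01 ?a10 ?a11 => h;
by [ring | apply: (mulfI n2); apply: (eq_lincomb (c := -1) h); ring
 | apply: (mulfI n4); apply: (eq_lincomb (c := -1) h); ring
 | apply: (mulfI n6); apply: (eq_lincomb (c := -1) h); ring].
Qed.

(** * Rigidity of normalized morphisms *)

Section Normalized.
Variables (U : {vspace bilin V}) (h : 'Hom(bilin V, bilin V)).
Hypothesis hU : subalgebra (bmul v1) U.
Hypothesis S2U : (S2 v1 v2 <= U)%VS.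
Hypothesis hM : {in U &, {morph h : A B / A ** B}}.

Lemma memU : [/\ e1 \in U, e2 \in U, e3 \in U & e4 \in U].
Proof.
by split; apply: (subvP S2U); rewrite memv_span// !inE eqxx ?orbT.
Qed.

Hypothesis h1 : forall j k, sc (h e1) 0 j k = sc e1 0 j k.
Hypothesis h2 : h e2 v1 v1 = v2.

Lemma normalized_S2 : [/\ h e1 = e1, h e2 = e2, h e3 = e3 & h e4 = e4].
Proof.
have [U1 U2 U3 U4] := memU; have n2 := natf_neq0 1.
have [] := @weight_spaces (h e1); rewrite ?h1 ?sc_e1 // => wm3 w3.
have {wm3} he2 : h e2 = e2.
  rewrite (wm3 (h e2)) ?/sc /=; last by rewrite -hM// e1e2 linearN linearZ.
  by rewrite h2 coord_v2 scale1r.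
have {w3} [m he4] : exists m, h e4 = m *: e4.
  by exists (sc (h e4) 1 1 0); apply: w3; rewrite -hM// e1e4 linearZ.
have he3 : h e3 = m *: e3.
  rewrite -[in LHS]e2e4 hM// he2 he4 -e2e4.
  by apply: sc_inj => *; rewrite !scE; ring.
have he1 : h e1 = m *: e1.
  apply: (scalerI n2); rewrite -linearZ /= -e2e3 hM// he2 he3.
  rewrite scalerA mulrC -scalerA -e2e3.
  by apply: sc_inj => *; rewrite !scE; ring.
(* The v1-coordinate of e1(v1, v1) is 1, and [h1] preserves it. *)
have m1 : m = 1 by have := h1 0 0; rewrite he1 !scE /= mulr1.
by rewrite he1 he2 he3 he4 m1 !scale1r.
Qed.

Lemma normalized_id : {in U, forall B, h B = B}.
Proof.
have [U1 U2 U3 U4] := memU; have [he1 he2 he3 he4] := normalized_S2.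
have h_left A : A \in U -> forall j k, sc (h A) 0 j k = sc A 0 j k.
  move=> UA; apply: left_action_inj.
    by rewrite -{1}he2 -hM// !mul_e2 linearD !linearZ /= he1 he2.
  by rewrite -{1}he4 -hM// !mul_e4 linearD !linearZ /= he3 he4.
move=> B UB; apply: sc_inj; apply: ord2P => [|j k]; first exact: h_left.
(* As e2(v1, v1) = v2, (e2 ** B)(v1, y) is -B(v2, y) plus terms that involve B only through B(v1,
   .). *)
have := h_left _ (hU U2 UB) j k; rewrite hM// he2 !scE.
move: j k; do 2! apply: ord2P; rewrite /= !h_left// => eqB;
  by apply: (eq_lincomb (c := -1) eqB); ring.
Qed.

End Normalized.

(** * Recovering f from an automorphism *)

Lemma exists_GLstab w : coord v 1 w != 0 -> exists f : GLstab v1, f v2 = w.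
Proof.
move=> nw; pose f0 x := coord v 0 x *: v1 + coord v 1 x *: w.
have f0_lin : linear f0.
  move=> a x y; rewrite /f0 scalerDr !scalerA (linearP (coord v 0)).
  by rewrite (linearP (coord v 1)) /= !scalerDl addrACA.
pose f0_mixin := GRing.isLinear.Build F V V *:%R f0 f0_lin.
pose f1 : {linear V -> V} := HB.pack f0 f0_mixin.
have fE x : linfun f1 x = f0 x by exact: lfunE.
have f_v1 : linfun f1 v1 = v1.
  by rewrite fE /f0 !coord_v1 scale1r scale0r addr0.
have f_v2 : linfun f1 v2 = w.
  by rewrite fE /f0 !coord_v2 scale1r scale0r add0r.
have f_bij : bijective (linfun f1).
  apply/lker0_bij/lker0P => x y /eqP; rewrite -subr_eq0 -linearB /= => /eqP.
  set z := x - y; rewrite fE /f0 => fz; apply/subr0_eq; rewrite -/z.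
  have z1 : coord v 1 z = 0.
    have /eqP := congr1 (coord v 1) fz.
    rewrite linearD !linearZ /= coord_v1 mulr0 add0r linear0 mulf_eq0.
    by rewrite (negPf nw) orbF => /eqP.
  by rewrite (basis2_decomp z) -[RHS]fz z1 !scale0r.
have fP : `[< bijective (linfun f1) /\ linfun f1 v1 = v1 >] by apply/asboolP.
by exists (MkGLstab fP).
Qed.

Lemma Phi_diag (f : GLstab v1) A x y : Phi v1 f A (f x) (f y) = f (A x y).
Proof. by rewrite PhiE !bij_lfunK//; exact: GLstab_bij. Qed.

(** [G] lives on the whole space but is constrained on U only, so that automorphisms of W(2), W_2
    and S_2 are treated at once. *)
Lemma exists_Phi_eq (U : {vspace bilin V}) (G : 'Hom(bilin V, bilin V)) :
  subalgebra (bmul v1) U -> (S2 v1 v2 <= U)%VS ->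
  {in U &, {morph G : A B / A ** B}} -> {in U &, injective G} ->
  (forall A, A \in U -> exists2 B, B \in U & G B = A) ->
  exists f : GLstab v1, {in U, G =1 Phi v1 f}.
Proof.
move=> hU S2U GM GI GS; have [U1 U2 U3 U4] := memU S2U.
have G_neq0 A : A \in U -> A != 0 -> G A != 0.
  by move=> UA; apply: contra_neq => GA; apply: GI; rewrite ?mem0v// linear0.
have e_neq0 i j k A : sc A i j k != 0 -> A != 0.
  by apply: contraNneq => ->; rewrite sc0.
have n3 : G e3 != 0.
  by apply/G_neq0/(e_neq0 1 1 1) => //; rewrite sc_e3 /= oner_eq0.
have n4 : G e4 != 0.
  by apply/G_neq0/(e_neq0 1 1 0) => //; rewrite sc_e4 /= oner_eq0.
(* [G e4] annihilates the image of U, which contains e2 and e4. *)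
have B0 j k : sc (G e4) 0 j k = 0.
  apply: left_action_eq0.
    by have [X UX <-] := GS _ U2; rewrite -GM// e4M linear0.
  by have [X UX XE] := GS _ U4; rewrite -[X in _ ** X]XE -GM// e4M linear0.
have [a00 a01 a11] : [/\ sc (G e1) 0 0 0 = 1, sc (G e1) 0 0 1 = 0
    & sc (G e1) 0 1 1 = -1].
  apply: (upper_triangular B0 n4 n3); rewrite -GM//.
  - by rewrite e1e4 linearZ.
  - by rewrite e3e4 linear0.
  - by rewrite e1e1 linearN.
  - by rewrite e1e3.
  - by rewrite e3e1 linearN linearZ.
have [|| Aw nw] := weight_m3_eigen (B := G e4) (E := G e2) a00 a01 a11.
- by rewrite -GM// e1e2 linearN linearZ.
- by rewrite -GM// e2e4.
have [f fv2] := exists_GLstab nw; have fv1 := GLstab_fix f.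
have f_inj := bij_inj (GLstab_bij f); have Phi_bij := alg_aut_bij (Phi v1 f).
pose h := (alg_autV (Phi v1 f) \o G)%VF.
have PhiK A : Phi v1 f (h A) = G A by rewrite [h A]lfunE; exact: (bij_lfunVK Phi_bij).
have hM : {in U &, {morph h : A B / A ** B}}.
  move=> A B UA UB; apply: (bij_inj Phi_bij).
  by rewrite PhiK (alg_autP (Phi v1 f)).2 !PhiK GM.
have Ge1v1 : G e1 v1 v1 = v1.
  by apply: coord2_inj => k; rewrite coord_v1; move: k; apply: ord2P.
(* Transported by f, this is the choice of [f v2] as (G e2)(v1, v1). *)
have h2 : h e2 v1 v1 = v2 by apply: f_inj; rewrite -Phi_diag PhiK fv1.
have e1v1 : e1 v1 v1 = v1.
  apply: coord2_inj => k; rewrite coord_v1 -[LHS]/(sc e1 0 0 k) sc_e1.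
  by move: k; apply: ord2P.
have e1v2 : e1 v1 v2 = - v2.
  apply: coord2_inj => k; rewrite linearN /= coord_v2 -[LHS]/(sc e1 0 1 k).
  by rewrite sc_e1; move: k; apply: ord2P; rewrite /= ?oppr0.
have he1v1 : h e1 v1 v1 = e1 v1 v1.
  by apply: f_inj; rewrite e1v1 fv1 -[LHS]Phi_diag PhiK fv1.
(* Here [Aw] enters: [f v2] is an eigenvector of (G e1)(v1, .) for -1. *)
have he1v2 : h e1 v1 v2 = e1 v1 v2.
  by apply: f_inj; rewrite e1v2 linearN /= fv2 -Aw -[LHS]Phi_diag PhiK fv1 fv2.
have h1 j k : sc (h e1) 0 j k = sc e1 0 j k.
  by congr (coord v k _); move: j; apply: ord2P; [exact: he1v1|exact: he1v2].
exists f => A UA; rewrite -[in RHS](normalized_id hU S2U hM h1 h2 UA).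
by rewrite PhiK.
Qed.

(** As e2(v1, v1) = v2, the value of Phi(f)(e2) at (v1, v1) is [f v2]. Since e2 lies in all three
    algebras, injectivity follows on each. *)
Lemma Phi_inj_e2 (f g : GLstab v1) : Phi v1 f e2 = Phi v1 g e2 -> f = g.
Proof.
move=> fg; have e2v1 : e2 v1 v1 = v2.
  apply: coord2_inj => k; rewrite coord_v2 -[LHS]/(sc e2 0 0 k) sc_e2.
  by move: k; apply: ord2P.
apply/val_inj/lfun_eq2; first by rewrite /= !GLstab_fix.
by rewrite /= -e2v1 -!Phi_diag fg !GLstab_fix.
Qed.

(** * Bijectivity of Phi and of its restrictions *)

Lemma Phi_bij : bijective (Phi v1).
Proof.
apply: inj_surj_bij => [f g fg|g]; first by apply: Phi_inj_e2; rewrite fg.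
have [g_inj g_mul] := alg_autP g; have /bij_inj gI := g_inj.
have [||||A _|f fg] := @exists_Phi_eq fullv g.
- by move=> *; exact: memvf.
- exact: subvf.
- by move=> A B _ _; exact: g_mul.
- by move=> A B _ _; exact: gI.
- by exists (g^-1%VF A); rewrite ?memvf ?bij_lfunVK.
- by exists f; apply/val_inj/lfunP => A; rewrite fg ?memvf.
Qed.

Lemma restr_Phi_bij (S : {vspace bilin V}) (hS : subalgebra (bmul v1) S)
    (PhiS : forall f, (Phi v1 f @: S)%VS = S) :
  (S2 v1 v2 <= S)%VS -> bijective (restr_hom (phi := Phi v1) hS PhiS).
Proof.
move=> S2S; have [_ Se2 _ _] := memU S2S.
apply: inj_surj_bij => [f g fg|g].
  apply: Phi_inj_e2.
  by rewrite -(vsprojK Se2) -!(restr_homE hS PhiS) fg.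
have [g_inj g_mul] := alg_autP g; have /bij_inj gI := g_inj.
(* Extends g to the whole space through the projection onto S, which is the identity on S. *)
pose G := linfun (vsval \o (g \o vsproj S)).
have GE A : G A = vsval (g (vsproj S A)) by rewrite lfunE.
have [||||A SA|f fg] := @exists_Phi_eq S G => //.
- move=> A B SA SB; rewrite !GE -sub_mulE// -g_mul; congr (vsval (g _)).
  by apply: subvs_inj; rewrite vsprojK ?hS// sub_mulE// !vsprojK.
- move=> A B SA SB; rewrite !GE => /subvs_inj/gI /(congr1 vsval).
  by rewrite !vsprojK.
- exists (vsval (g^-1%VF (vsproj S A))); first exact: subvsP.
  by rewrite GE vsvalK bij_lfunVK// vsprojK.
- exists f; apply/val_inj/lfunP => a; apply: subvs_inj.
  by rewrite [LHS](restr_homE hS PhiS) -fg ?subvsP// GE vsvalK.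
Qed.

Lemma S2_sub_W2 : (S2 v1 v2 <= W2 v1 v2)%VS.
Proof.
apply: sub_span => B; rewrite !inE.
by move=> /or4P[] /eqP ->; rewrite eqxx ?orbT.
Qed.

(** * GL(V, v1) as the affine matrix group *)

Definition affine_of_GLstab_mx (f : GLstab v1) : 'M[F]_2 :=
  \matrix_(i, j) coord v i (f (tnth v j)).

Fact affine_of_GLstab_subproof f : is_affine_mx (affine_of_GLstab_mx f).
Proof.
apply/and3P; rewrite !mxE (tnth_nth 0 v 0) (tnth_nth 0 v 1) /= GLstab_fix.
rewrite !coord_v1 eqxx; split=> //; apply/eqP => fv2.
(* Without a v2-coordinate, [f v2] would be the image of a multiple of v1, against injectivity. *)
have fv2E : f v2 = f (coord v 0 (f v2) *: v1).
  by rewrite linearZ /= GLstab_fix {1}(basis2_decomp (f v2)) fv2 scale0r addr0.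
have /(congr1 (coord v 1)) := bij_inj (GLstab_bij f) fv2E.
rewrite linearZ /= coord_v1 coord_v2 mulr0 => /eqP.
by rewrite oner_eq0.
Qed.

Definition affine_of_GLstab f := MkAffineMx (affine_of_GLstab_subproof f).

Fact affine_of_GLstabM : {morph affine_of_GLstab : f g / (f * g)%g}.
Proof.
move=> f g; apply/val_inj/matrixP => i j.
rewrite !mxE big_ord_recl big_ord1 [lift _ _](_ : _ = 1); last exact: val_inj.
rewrite !mxE [val _]/= lfunE /= (tnth_nth 0 v 0) (tnth_nth 0 v 1) /=.
by rewrite {1}(basis2_decomp (g _)) !linearD !linearZ /= !(mulrC (coord v i _)).
Qed.

HB.instance Definition _ := isMultiplicative.Build (GLstab v1) (affine_mx F)
  affine_of_GLstab affine_of_GLstabM.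

Lemma affine_of_GLstab_bij : bijective affine_of_GLstab.
Proof.
apply: inj_surj_bij => [f g fg|M].
  apply/val_inj/lfun_eq2; first by rewrite /= !GLstab_fix.
  apply: coord2_inj => i.
  by have := congr1 (fun M : affine_mx F => M i 1) fg; rewrite !mxE.
have [M00 M10 M11] := affine_mxP M.
have cw i : coord v i (M 0 1 *: v1 + M 1 1 *: v2) = M i 1.
  rewrite linearD !linearZ /= coord_v1 coord_v2; move: i.
  by apply: ord2P; rewrite /= !(mulr0, mulr1, addr0, add0r).
(* The preimage of M sends v2 to the second column of M. *)
have [|f fv2] := @exists_GLstab (M 0 1 *: v1 + M 1 1 *: v2); first by rewrite cw.
exists f; apply/val_inj/matrixP => i j; rewrite mxE; move: j; apply: ord2P.
  rewrite (tnth_nth 0 v 0) /= GLstab_fix coord_v1; move: i.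
  by apply: ord2P; rewrite ?M00 ?M10.
by rewrite (tnth_nth 0 v 1) /= fv2 cw.
Qed.

End Automorphisms.

Theorem theorem11 (F : fieldType) (hF : [pchar F]%R =i pred0)
    (V : vectType F) (v1 v2 : V) (hv : basis_of fullv [:: v1; v2]) :
  [/\ bijective (Phi v1),
      bijective (Phi_on_W2 hv hF),
      bijective (Phi_on_S2 hv) &
      [/\ group_isomorphic (alg_aut (bmul v1))
                           (alg_aut (sub_mul (bmul v1) (W2 v1 v2))),
          group_isomorphic (alg_aut (sub_mul (bmul v1) (W2 v1 v2)))
                           (alg_aut (sub_mul (bmul v1) (S2 v1 v2))) &
          group_isomorphic (alg_aut (bmul v1)) (affine_mx F)]].
Proof.
have bPhi := Phi_bij hv hF.
have bW : bijective (Phi_on_W2 hv hF).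
  exact: (restr_Phi_bij hv hF _ _ (S2_sub_W2 v1 v2)).
have bS : bijective (Phi_on_S2 hv).
  exact: (restr_Phi_bij hv hF _ _ (subvv _)).
split=> //; split.
- exact: (group_isomorphic_cancel bPhi bW).
- exact: (group_isomorphic_cancel bW bS).
- exact: (group_isomorphic_cancel bPhi (affine_of_GLstab_bij hv)).
Qed.
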